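(* Let $\{(X_i,d_i)\}_{i=1}^\infty$ be a sequence of compact length spaces that converges in the Gromov-Hausdorff topology to a compact length space $(X,d)$. Let $f_i:X_i\to X$ be $\varepsilon_i$-approximations, with $\varepsilon_i\to0$, that realize the Gromov-Hausdorff convergence. For each $i$, let $\Pi_i$ be a Borel probability measure on $\Gamma(X_i)$, and let $\pi_i=E_*\Pi_i$ and $\mu_{i,t}=(e_t)_*\Pi_i$, $t\in[0,1]$, be the associated transference plan and measure-valued path. Then, after passing to a subsequence, there is a dynamical transference plan $\Pi$ on $X$ (a Borel probability measure on $\Gamma(X)$), with associated transference plan $\pi=E_*\Pi$ and measure-valued path $\mu_t=(e_t)_*\Pi$, $t\in[0,1]$, such that (i) $\lim_{i\to\infty}(f_i,f_i)_*\pi_i=\pi$ in the weak-$*$ topology on $P(X\times X)$; (ii) $\lim_{i\to\infty}(f_i)_*\mu_{i,t}=\mu_t$ in the weak-$*$ topology on $P(X)$ for all $t\in[0,1]$.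
   Context: For a compact length space $Y$, $\Gamma(Y)$ is the set of minimizing constant-speed geodesics $\gamma:[0,1]\to Y$ (with the topology of uniform convergence), $e_t:\Gamma(Y)\to Y$ is $e_t(\gamma)=\gamma(t)$, and $E=(e_0,e_1):\Gamma(Y)\to Y\times Y$. $P(\cdot)$ denotes Borel probability measures. An $\varepsilon$-approximation $f:Y\to X$ is a Borel map such that $|d_X(f(y),f(y'))-d_Y(y,y')|\le\varepsilon$ for all $y,y'\in Y$, and for every $x\in X$ there is $y\in Y$ with $d_X(f(y),x)\le\varepsilon$. The spaces $X_i$ converge to $X$ in the Gromov-Hausdorff topology if there are $\varepsilon_i$-approximations $f_i:X_i\to X$ with $\varepsilon_i\to0$. $(f_i,f_i):X_i\times X_i\to X\times X$ denotes the product map. *)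

(* Defs.v *)
From HB Require Import structures.
From mathcomp Require Import all_boot all_order all_algebra.
From mathcomp Require Import all_classical all_reals all_analysis.
From mathcomp Require Import homotopy.

Set Implicit Arguments.
Unset Strict Implicit.
Unset Printing Implicit Defensive.

Import Order.TTheory GRing.Theory Num.Theory.
Import numFieldTopology.Exports numFieldNormedType.Exports.

Local Open Scope classical_set_scope.
Local Open Scope ring_scope.

(* A measurableType carries a base point, hence so must a metric space with its
   Borel sigma-algebra; the point only records that the space is nonempty. *)
#[short(type="pmetricType")]
HB.structure Definition PointedMetric (R : numDomainType) :=
  {M of Metric R M & isPointed M}.

HB.instance Definition _ (X Y : ptopologicalType) := Pointed.on (X * Y)%type.

Notation borel T := (g_sigma_algebraType (@open T)).

Section unit_interval.
Variable R : realType.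

Definition unit_interval : Type := set_type (`[0, 1]%classic : set R).

HB.instance Definition _ := Uniform.on unit_interval.

Let zero_itv : (0 : R) \in (`[0, 1]%classic : set R).
Proof. by rewrite inE /= in_itv /= lexx ler01. Qed.

Let one_itv : (1 : R) \in (`[0, 1]%classic : set R).
Proof. by rewrite inE /= in_itv /= lexx ler01. Qed.

Let zero_one_neq :
  exist _ 0 zero_itv != exist _ 1 one_itv :> unit_interval.
Proof. by rewrite -val_eqE /= eq_sym oner_neq0. Qed.

HB.instance Definition _ := @isBiPointed.Build unit_interval
  (exist _ 0 zero_itv) (exist _ 1 one_itv) zero_one_neq.

Definition time (t : unit_interval) : R := \val t.

Definition le_time (s t : unit_interval) : bool := time s <= time t.

End unit_interval.

Section length_space.
Variables (R : realType) (X : metricType R).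
Local Notation I := (unit_interval R).

Definition chain_length (gamma : I -> X) (s : I) (p : seq I) : R :=
  \sum_(uv <- zip (s :: p) p) mdist (gamma uv.1) (gamma uv.2).

(* Length of gamma restricted to [s, t], for s <= t: the supremum runs over the
   subdivisions s <= p_1 <= ... <= p_n = t. *)
Definition curve_length (gamma : I -> X) (s t : I) : \bar R :=
  ereal_sup [set (chain_length gamma s p)%:E
    | p in [set p : seq I | path (@le_time R) s p /\ last s p = t]].

Definition length_space : Prop := forall x y : X,
  (mdist x y)%:E =
  ereal_inf (range (fun gamma : {path I from x to y} =>
    curve_length gamma zero one)).

Definition minimizing (gamma : I -> X) : Prop :=
  curve_length gamma zero one = (mdist (gamma zero) (gamma one))%:E.

Definition constant_speed (gamma : I -> X) : Prop :=
  exists v : R, forall s t : I, le_time s t ->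
    curve_length gamma s t = (v * (time t - time s))%:E.

Definition is_geodesic : set {uniform I -> X} :=
  [set gamma | [/\ continuous (gamma : I -> X), minimizing gamma
    & constant_speed gamma]].

(* The topology is the one induced by uniform convergence. *)
Definition geodesic_space : Type := set_type is_geodesic.

HB.instance Definition _ := Uniform.on geodesic_space.

Definition evaluation (t : I) (gamma : geodesic_space) : X :=
  (\val gamma : I -> X) t.

Definition endpoints (gamma : geodesic_space) : X * X :=
  (evaluation zero gamma, evaluation one gamma).

Lemma curve_length_cst (x : X) (s t : I) : le_time s t ->
  curve_length (fun=> x) s t = 0%:E.
Proof.
move=> st; rewrite /curve_length.
rewrite [X in ereal_sup X](_ : _ = [set 0%:E]) ?ereal_sup1//.
have cl0 p : chain_length (fun=> x) s p = 0.
  by rewrite /chain_length big1// => uv _; rewrite mdistxx.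
apply/seteqP; split => [_ [p _ <-]|_ ->]/=; first by rewrite cl0.
by exists [:: t]; rewrite ?cl0//= st.
Qed.

Lemma is_geodesic_cst (x : X) : is_geodesic (fun=> x).
Proof.
split; first exact: cst_continuous.
- by rewrite /minimizing curve_length_cst ?mdistxx// /le_time ler01.
- by exists 0 => s t st; rewrite curve_length_cst// mul0r.
Qed.

End length_space.

Section pointed_geodesics.
Variables (R : realType) (X : pmetricType R).

(* A constant geodesic as base point. *)
HB.instance Definition _ := isPointed.Build (geodesic_space X)
  (exist (fun gamma => gamma \in @is_geodesic R X) _
     (mem_set (is_geodesic_cst (point : X)))).

End pointed_geodesics.

Definition eps_approximation (R : realType) (eps : R) (Y X : pmetricType R)
    (f : Y -> X) : Prop :=
  [/\ measurable_fun [set: borel Y] (f : borel Y -> borel X),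
      forall y y' : Y, `|mdist (f y) (f y') - mdist y y'| <= eps
    & forall x : X, exists y : Y, mdist (f y) x <= eps].

(* All pushforwards below are along Borel maps (evaluation and endpoints are
   continuous), so they are measures, although `pushforward` is defined for
   arbitrary set functions. *)
Section measures.
Variable R : realType.

Definition transference_plan (X : pmetricType R)
    (Pi : set (borel (geodesic_space X)) -> \bar R) :
    set (borel (X * X)%type) -> \bar R :=
  pushforward Pi
    (@endpoints R X : borel (geodesic_space X) -> borel (X * X)%type).

Definition measure_path (X : pmetricType R)
    (Pi : set (borel (geodesic_space X)) -> \bar R) (t : unit_interval R) :
    set (borel X) -> \bar R :=
  pushforward Pi (@evaluation R X t : borel (geodesic_space X) -> borel X).

Definition borel_pushforward (Y X : ptopologicalType) (f : Y -> X)
    (mu : set (borel Y) -> \bar R) : set (borel X) -> \bar R :=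
  pushforward mu (f : borel Y -> borel X).

Definition prod_map (Y X : Type) (f : Y -> X) (y : Y * Y) : X * X :=
  (f y.1, f y.2).

(* Weak-* convergence on P(X) for X compact, where continuous functions are
   bounded. *)
Definition weak_star_cvg (X : ptopologicalType)
    (mu_ : nat -> set (borel X) -> \bar R) (mu : set (borel X) -> \bar R) :
    Prop :=
  forall h : X -> R, continuous h ->
    (\int[mu_ n]_(x in [set: borel X]) (h x)%:E)%E @[n --> \oo] -->
    (\int[mu]_(x in [set: borel X]) (h x)%:E)%E.

End measures.

(* Main.v *)
Require Import Defs.
From HB Require Import structures.
From mathcomp Require Import all_boot all_order all_algebra.
From mathcomp Require Import all_classical all_reals all_analysis.
From mathcomp Require Import measurable_realfun lra.

Set Implicit Arguments.
Unset Strict Implicit.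
Unset Printing Implicit Defensive.

Import Order.TTheory GRing.Theory Num.Theory.
Import numFieldTopology.Exports numFieldNormedType.Exports.

Local Open Scope classical_set_scope.
Local Open Scope ring_scope.

(** The images under [f_ i] of the geodesics of [X_ i] are
    curves in [X], possibly discontinuous, whose distances are those of a
    geodesic up to an error that tends to 0. Such a curve is described, up to a
    small uniform error, by finitely many bits: whether its position at time
    [j / (n + 1)] lies within [1 / (n + 1)] of the [a]-th point of a finite net
    of [X]. Listing all these questions turns each [Pi_ i] into a distribution
    of infinite bit sequences.

    Laws of bit sequences have convergent subsequences for an elementary reason:
    a diagonal extraction makes the probability of every finite word converge
    ([code_subsequence]), the limits are nonnegative and additive, and so they
    are the lengths of the intervals of a nested binary subdivision of [[0, 1[]:
    the bits of the address of a Lebesgue-random point have the limit law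
    ([bits_distribution]). All subdivision intervals that contain a point have
    positive length, so every prefix of such an address is realized by a
    geodesic of [X_ i] for infinitely many [i]. As the coarse curves with given
    longer and longer prefixes form a uniform Cauchy family, they converge, and
    their limit is a geodesic of [X] ([coarse_geodesic_limit]). Sending a point
    of [[0, 1[] to this limit geodesic is a Borel map, and [Pi] is the image of
    Lebesgue measure.

    Weak-* convergence then holds because an integral over bit sequences of a
    function determined, up to a small error, by a prefix is nearly a finite sum
    over words, each term of which converges ([cvg_Rintegral_of_cylinders]). *)

(** * Binary words and cylinders *)

(** The latest bit comes first, so that reading one more bit is a [cons]. *)
Fixpoint word (b : nat -> bool) (m : nat) : seq bool :=
  if m is m'.+1 then b m' :: word b m' else [::].

Lemma size_word b m : size (word b m) = m.
Proof. by elim: m => //= m ->. Qed.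

Lemma eq_word b b' m :
  word b m = word b' m <-> forall k, (k < m)%N -> b k = b' k.
Proof.
elim: m => [|m IH] /=; first by split.
split=> [[bm /IH ww] k|bb].
  by rewrite ltnS leq_eqVlt => /predU1P[->//|/ww].
by rewrite bb// IH.2// => k km; rewrite bb// ltnS ltnW.
Qed.

Lemma word_leq b b' m n : (m <= n)%N -> word b n = word b' n ->
  word b m = word b' m.
Proof.
by move=> mn /eq_word h; apply/eq_word => k km; apply: h; exact: leq_trans mn.
Qed.

(** The points whose bit sequence has the prefix [v]. The length of the word is
    that of [v], so that the cylinders of [false :: v] and [true :: v] halve
    that of [v]. *)
Definition cylinder (T : Type) (b : T -> nat -> bool) (v : seq bool) : set T :=
  [set x | word (b x) (size v) = v].

Lemma measurable_word d (T : measurableType d) (b : T -> nat -> bool)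
    (mb : forall k, measurable [set x | b x k]) m v :
  measurable [set x | word (b x) m = v].
Proof.
elim: m v => [|m IH] [|a v] /=.
- by rewrite (_ : [set _ | _] = setT)//; apply/seteqP.
- by rewrite (_ : [set _ | _] = set0)//; apply/seteqP; split => // x.
- by rewrite (_ : [set _ | _] = set0)//; apply/seteqP; split => // x.
rewrite (_ : [set _ | _] = [set x | word (b x) m = v] `&`
    (if a then [set x | b x m] else ~` [set x | b x m])); last first.
  apply/seteqP; split => [x /= [<- <-]|x /= [<-]].
    by split=> //; case: ifPn => //= /negP.
  by case: a => /=; [move=> -> | move=> /negP/negbTE ->].
by apply: measurableI; [exact: IH | case: a => //; exact: measurableC].
Qed.

Section cylinder_probability.
Context d (T : measurableType d) (R : realType) (P : probability T R).
Variable b : T -> nat -> bool.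
Hypothesis mb : forall k, measurable [set x | b x k].

Lemma measurable_cylinder v : measurable (cylinder b v).
Proof. exact: measurable_word. Qed.

(** A prefix takes countably many values, on each of which the function is
    constant. *)
Lemma measurable_fun_word d' (T' : measurableType d') (h : seq bool -> T') m :
  measurable_fun [set: T] (fun x => h (word (b x) m)).
Proof.
move=> _ Y mY; rewrite setTI (_ : _ @^-1` _ =
    \bigcup_(v : seq bool) [set x | word (b x) m = v /\ Y (h v)]).
  apply: countable_bigcupT_measurable => // v.
  have [Yv|Yv] := pselect (Y (h v)).
    rewrite (_ : [set _ | _] = [set x | word (b x) m = v]).
      exact: measurable_word.
    by apply/seteqP; split => x /=; [case|split].
  by rewrite (_ : [set _ | _] = set0)//; apply/seteqP; split => x //= -[].
by apply/seteqP; split => [x Yx|x [v _ [/= -> ]]//]; exists (word (b x) m).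
Qed.

Lemma cylinder_fin v : P (cylinder b v) \is a fin_num.
Proof. exact/fin_num_measure/measurable_cylinder. Qed.

Lemma cylinder01 v : 0 <= fine (P (cylinder b v)) <= 1.
Proof.
by rewrite fine_ge0//= -lee_fin fineK ?cylinder_fin// probability_le1//;
  exact: measurable_cylinder.
Qed.

Lemma cylinder_nil : fine (P (cylinder b [::])) = 1.
Proof.
by rewrite (_ : cylinder _ _ = setT) ?probability_setT//; apply/seteqP; split.
Qed.

Lemma cylinder_cons v : fine (P (cylinder b v)) =
  fine (P (cylinder b (false :: v))) + fine (P (cylinder b (true :: v))).
Proof.
rewrite -fineD ?cylinder_fin// -measureU; try exact: measurable_cylinder.
  congr (fine (P _)); apply/seteqP; split=> x; rewrite /cylinder/=.
    by case: (b x _) => ->; [right|left].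
  by move=> [] [].
apply/seteqP; split => // x; rewrite /cylinder/= => -[[bf _] [bt _]].
by rewrite bf in bt.
Qed.

(** A function of the first [m] bits is a step function on the [2 ^ m] cylinders
    of length [m]. *)
Lemma integral_word (h : seq bool -> R) m :
  \int[P]_x h (word (b x) m) =
  \sum_(v : m.-tuple bool) h v * fine (P (cylinder b v)).
Proof.
have UT : \big[setU/set0]_(v : m.-tuple bool) cylinder b v = [set: T].
  apply/seteqP; split => // x _.
  by rewrite (bigD1 (Tuple (introT eqP (size_word (b x) m))))//; left;
    rewrite /cylinder/= size_word.
have tE (v : m.-tuple bool) x : cylinder b v x -> word (b x) m = v.
  by rewrite /cylinder/= size_tuple.
rewrite /Rintegral -UT integral_bigsetU_EFin/=; first last.
- rewrite UT; exact/measurable_EFinP/measurable_fun_word.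
- apply/trivIsetP => v v' _ _ /eqP vv'; apply/seteqP; split => // x [/tE xv /tE xv'].
  by apply: vv'; apply/val_inj; rewrite /= -xv -xv'.
- exact: index_enum_uniq.
- move=> v; exact: measurable_cylinder.
under eq_bigr => v _.
  rewrite (eq_integral (fun=> (h v)%:E)); last first.
    by move=> x /[!inE] /tE ->.
  rewrite integral_cst; last exact: measurable_cylinder.
  over.
rewrite -sum_fine; last by move=> v _; rewrite fin_numM// cylinder_fin.
by apply: eq_bigr => v _; rewrite fineM// cylinder_fin.
Qed.

End cylinder_probability.

(** * Bit sequences with prescribed word probabilities *)

Section binary_subdivision.
Variables (R : realType) (w : seq bool -> R).
Hypotheses (w1 : w [::] = 1) (w_ge0 : forall v, 0 <= w v)
  (wD : forall v, w v = w (false :: v) + w (true :: v)).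

(** The interval of [v] is [[left_end v, left_end v + w v[]; it is cut at
    [left_end v + w (false :: v)] into the intervals of its two successors. *)
Fixpoint left_end (v : seq bool) : R :=
  if v is a :: v' then left_end v' + (if a then w (false :: v') else 0)
  else 0.

(** The address of [u]: at each step, the half of the current interval that
    contains [u]. *)
Fixpoint subdivision_word (u : R) (m : nat) : seq bool :=
  if m is m'.+1 then let v := subdivision_word u m' in
    (left_end (true :: v) <= u) :: v
  else [::].

Lemma subdivision_wordE (u : R) m v : 0 <= u < 1 -> size v = m ->
  (subdivision_word u m = v) <-> (left_end v <= u < left_end v + w v).
Proof.
move=> u01; elim: m v => [|m IH] [|a v] //= => [_|[sv]].
  by rewrite w1 add0r.
have wv := wD v; have wf := w_ge0 (false :: v); have wt := w_ge0 (true :: v).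
split=> [[<- sw]|].
  have : left_end v <= u < left_end v + w v by apply/IH.
  by rewrite sw; case: (leP (left_end v + w (false :: v)) u); lra.
move=> h; have sw : subdivision_word u m = v.
  by apply/IH => //; move: h; case: a; lra.
by rewrite sw; congr (_ :: _); move: h; case: a; case: leP => //; lra.
Qed.

(** Points outside [[0, 1[] have no address; sending them to 0 gives every
    point an address all of whose prefixes have positive weight. *)
Definition fractional (u : R) : R := if 0 <= u < 1 then u else 0.

Lemma fractional01 u : 0 <= fractional u < 1.
Proof. by rewrite /fractional; case: ifPn => //; rewrite lexx ltr01. Qed.

Definition subdivision_bit (u : R) (k : nat) : bool :=
  left_end (true :: subdivision_word (fractional u) k) <= fractional u.

Lemma word_subdivision_bit u m :
  word (subdivision_bit u) m = subdivision_word (fractional u) m.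
Proof. by elim: m => //= m ->. Qed.

End binary_subdivision.

(** Lebesgue measure restricted to [[0, 1[], seen as a probability on the line. *)
Definition unit_lebesgue (R : realType) : set (measurableTypeR R) -> \bar R :=
  mrestr lebesgue_measure (measurable_itv `[(0 : R), 1[).

Section unit_lebesgue.
Variable R : realType.
HB.instance Definition _ := Measure.on (@unit_lebesgue R).

Let unit_lebesgueT : @unit_lebesgue R setT = 1%E.
Proof.
by rewrite /unit_lebesgue /mrestr setTI lebesgue_measure_itv/= lte_fin ltr01 sube0.
Qed.

HB.instance Definition _ :=
  Measure_isProbability.Build _ _ R (@unit_lebesgue R) unit_lebesgueT.
End unit_lebesgue.

Lemma measurable_fractional (R : realType) :
  measurable_fun [set: measurableTypeR R] (@fractional R).
Proof.
apply: measurable_fun_ifT => //.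
apply: (measurable_fun_bool true); rewrite setTI (_ : _ @^-1` _ = `[(0 : R), 1[%classic).
  exact: measurable_itv.
by apply/seteqP; split => u /=; rewrite in_itv.
Qed.

(** Kolmogorov extension for bit sequences, by subdivision of [[0, 1[]: the word
    [v] is a prefix of the address of [u] exactly when [u] lies in the interval
    of [v], whose length is [w v]. An interval that contains a point is nonempty
    and half-open, hence the third clause holds at every point and not only
    almost everywhere. *)
Lemma bits_distribution (R : realType) (w : seq bool -> R)
    (w1 : w [::] = 1) (w_ge0 : forall v, 0 <= w v)
    (wD : forall v, w v = w (false :: v) + w (true :: v)) :
  exists B : measurableTypeR R -> nat -> bool,
  [/\ forall k, measurable [set u | B u k],
      forall v, @unit_lebesgue R (cylinder B v) = (w v)%:E
    & forall u m, 0 < w (word (B u) m)].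
Proof.
have wordE v u : (word (subdivision_bit w u) (size v) = v) <->
    (left_end w v <= fractional u < left_end w v + w v).
  by rewrite word_subdivision_bit; apply: subdivision_wordE => //; exact: fractional01.
have left_itv v : 0 <= left_end w v /\ left_end w v + w v <= 1.
  elim: v => [|a v [IH1 IH2]] /=; first by rewrite w1 add0r.
  have := wD v; have := w_ge0 (false :: v); have := w_ge0 (true :: v).
  by case: a; lra.
have mword v : measurable [set u | word (subdivision_bit w u) (size v) = v].
  rewrite (_ : [set _ | _] =
      (@fractional R) @^-1` `[left_end w v, left_end w v + w v[); last first.
    by apply/seteqP; split => u /=; rewrite in_itv/= => /wordE.
  by rewrite -[X in measurable X]setTI; apply: measurable_fractional => //;
    exact: measurable_itv.
exists (subdivision_bit w); split.
- move=> k; rewrite (_ : [set _ | _] = \bigcup_(v : seq bool)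
      [set u | word (subdivision_bit w u) k.+1 = true :: v]).
    apply: countable_bigcupT_measurable => // v.
    have [vk|vk] := eqVneq (size v) k; first by rewrite -vk; exact: mword (true :: v).
    rewrite (_ : [set _ | _] = set0)//; apply/seteqP; split => // u [_ uv].
    by move: vk; rewrite -uv size_word eqxx.
  apply/seteqP; split => [u /= bk|u [v _] /= [bk _]//].
  by exists (word (subdivision_bit w u) k) => //=; congr cons.
- move=> v; rewrite /unit_lebesgue /mrestr.
  have [l0 l1] := left_itv v.
  rewrite (_ : _ `&` _ = `[left_end w v, left_end w v + w v[%classic).
    rewrite lebesgue_measure_itv/= lte_fin ltrDl; case: ltP => [_|wv].
      by rewrite -EFinD addrAC subrr add0r.
    by congr (_%:E); apply/eqP; rewrite eq_le wv w_ge0.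
  apply/seteqP; split => u /=; rewrite !in_itv/=.
    by move=> [/wordE + u01]; rewrite /fractional u01.
  move=> uv; have u01 : 0 <= u < 1 by lra.
  by split=> //; apply/wordE; rewrite /fractional u01.
- move=> u m; set v := word _ m.
  have /wordE : word (subdivision_bit w u) (size v) = v by rewrite size_word.
  by lra.
Qed.

(** * Subsequences along which all word probabilities converge *)

(** The cube indexed by [T] is compact, so the sequence has a cluster point. As
    [T] is countable, the condition of being close to it at the first [n]
    indices defines a neighbourhood, which the sequence visits infinitely
    often. *)
Lemma diagonal_extraction (R : realType) (T : countType) (x : nat -> T -> R)
    (x01 : forall n t, 0 <= x n t <= 1) :
  exists k : nat -> nat, {homo k : m n / (m < n)%N >-> (m < n)%N} /\
  exists l : T -> R, forall t, x (k n) t @[n --> \oo] --> l t.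
Proof.
have cube_compact := @tychonoff T (fun=> R) (fun=> `[(0 : R), 1]%classic)
  (fun=> @segment_compact R 0 1).
pose F := (x : nat -> prod_topology (fun _ : T => R)) @ \oo.
have FC : F [set f | forall t, `[(0 : R), 1]%classic (f t)].
  by exists 0%N => // n _ t /=; rewrite in_itv; exact: x01.
have [l [_ l_cluster]] := cube_compact F _ FC.
(* the countably many indices enter one by one along [pickle] *)
have near_l n : nbhs (l : prod_topology (fun _ : T => R))
    [set f | forall t, (pickle t < n)%N -> `|l t - f t| < n.+1%:R^-1].
  have coord t : nbhs (l : prod_topology (fun _ : T => R))
      [set f | `|l t - f t| < n.+1%:R^-1].
    have /cvgrPdist_lt :
        (f : T -> R) t @[f --> (l : prod_topology (fun _ : T => R))] --> l t.
      exact: (@proj_continuous T (fun=> R) t l).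
    by move=> /(_ (nbhs_filter l) n.+1%:R^-1); apply.
  have : forall m, nbhs (l : prod_topology (fun _ : T => R))
      [set f | forall t, (pickle t < m)%N -> `|l t - f t| < n.+1%:R^-1].
    elim=> [|m IH].
      by apply: (@filterE _ (nbhs l)) => f t; rewrite ltn0.
    case mt : (pickle_inv m : option T) => [t|].
      apply: (@filterS2 _ (nbhs l) _ _ _ _ _ IH (coord t)) => f IHf ft s.
      rewrite ltnS leq_eqVlt => /predU1P[sm|]; last exact: IHf.
      by have -> : s = t by apply: Some_inj; rewrite -mt -sm pickleK_inv.
    apply: (@filterS _ (nbhs l) _ _ _ _ IH) => f IHf s; rewrite ltnS leq_eqVlt.
    move=> /predU1P[sm|]; last exact: IHf.
    by move: mt; rewrite -sm pickleK_inv.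
  exact: (fun h => h n).
have step Nn : exists j, (Nn.1 < j)%N /\
    forall t, (pickle t < Nn.2)%N -> `|l t - x j t| < Nn.2.+1%:R^-1.
  case: Nn => N n /=.
  have [|_ [[j Nj <-] lj]] :=
      l_cluster [set x j | j in [set j | (N < j)%N]] _ _ (near_l n).
    exists N.+1 => // j /= Nj; by exists j.
  by exists j.
have [g gP] := choice step.
(* [g (N, n)] is a term after [N] that is close to [l] at the first [n] indices *)
pose k := fix k n := if n is n'.+1 then g (k n', n') else 0%N.
exists k; split.
  by apply: homo_ltn => [|n]; [exact: ltn_trans|exact: (gP (k n, n)).1].
exists l => t; rewrite -cvg_shiftS; apply/cvgrPdist_lt => e e0.
near=> n.
apply: lt_trans ((gP (k n, n)).2 t _) _ => /=.
  by near: n; exists (pickle t).+1.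
near: n; exact: near_infty_natSinv_lt (PosNum e0).
Unshelve. all: by end_near. Qed.

(** The limits of the probabilities of the words are again the weights of a law
    of bit sequences. The last clause links the limit to the sequence at every
    point: a prefix seen in the limit has positive limit probability, hence is
    eventually seen with positive probability. *)
Lemma code_subsequence (R : realType) (d_ : nat -> measure_display)
    (T_ : forall n, measurableType (d_ n)) (P_ : forall n, probability (T_ n) R)
    (b_ : forall n, T_ n -> nat -> bool)
    (mb_ : forall n k, measurable [set x | b_ n x k]) :
  exists k : nat -> nat, {homo k : m n / (m < n)%N >-> (m < n)%N} /\
  exists B : measurableTypeR R -> nat -> bool,
  [/\ forall j, measurable [set u | B u j],
      forall v, fine (P_ (k n) (cylinder (@b_ (k n)) v)) @[n --> \oo] -->
        fine (@unit_lebesgue R (cylinder B v))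
    & forall u m N, exists n, (N <= n)%N /\
        exists x : T_ (k n), word (b_ (k n) x) m = word (B u) m].
Proof.
have [k [k_incr [w wP]]] := @diagonal_extraction R (seq bool)
  (fun n v => fine (P_ n (cylinder (@b_ n) v)))
  (fun n => cylinder01 (P_ n) (mb_ n)).
have {}wP v : fine (P_ (k n) (cylinder (@b_ (k n)) v)) @[n --> \oo] --> w v.
  exact: wP.
have w1 : w [::] = 1.
  apply: (cvg_unique (@Rhausdorff R) (wP [::])).
  by apply: cvg_near_cst; apply: nearW => n; exact: cylinder_nil.
have w_ge0 v : 0 <= w v.
  rewrite -(cvg_lim (@Rhausdorff R) (wP v)).
  apply: limr_ge; first by apply: cvgP (wP v).
  by apply: nearW => n; have /andP[] := cylinder01 (P_ (k n)) (mb_ (k n)) v.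
have wD v : w v = w (false :: v) + w (true :: v).
  apply: (cvg_unique (@Rhausdorff R) (wP v)).
  apply: cvg_trans (cvgD (wP (false :: v)) (wP (true :: v))).
  apply: near_eq_cvg; apply: nearW => n /=.
  by rewrite [RHS]cylinder_cons.
have [B [mB PB B_gt0]] := bits_distribution w1 w_ge0 wD.
exists k; split => //; exists B; split => // [v|u m N].
  by rewrite PB.
have /cvgrPdist_lt /(_ _ (B_gt0 u m))[M _ MP] := wP (word (B u) m).
exists (maxn N M); split; first exact: leq_maxl.
have := MP _ (leq_maxr N M).
apply: contraPP => /forallNP noword; apply/negP.
rewrite (_ : cylinder _ _ = set0) ?measure0/= ?subr0 ?ltNge ?ler_norm//.
by apply/seteqP; split => // x; rewrite /cylinder/= size_word => /noword.
Qed.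

(** * Convergence of integrals from convergence on cylinders *)

Section bounded_Rintegral.
Context d (T : measurableType d) (R : realType) (P : probability T R).

Lemma probability_bounded_integrable (f : T -> R) (M : R) :
  measurable_fun [set: T] f -> (forall x, `|f x| <= M) ->
  P.-integrable [set: T] (EFin \o f).
Proof.
move=> mf fM; apply: measurable_bounded_integrable => //.
  by rewrite /= probability_setT ltry.
by exists M; split; [exact: num_real|move=> K MK x _; exact: le_trans (ltW MK)].
Qed.

Lemma ler_dist_Rintegral (f g t : T -> R) (M : R) :
  measurable_fun [set: T] f -> measurable_fun [set: T] g ->
  measurable_fun [set: T] t ->
  (forall x, `|f x| <= M) -> (forall x, `|g x| <= M) ->
  (forall x, `|t x| <= M) -> (forall x, `|f x - g x| <= t x) ->
  `|\int[P]_x f x - \int[P]_x g x| <= \int[P]_x t x.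
Proof.
move=> mf mg mt fM gM tM fgt.
have fi := probability_bounded_integrable mf fM.
have gi := probability_bounded_integrable mg gM.
have ti := probability_bounded_integrable mt tM.
have fgi : P.-integrable [set: T] (EFin \o (fun x => f x - g x)).
  rewrite (_ : _ \o _ = (EFin \o f) \- (EFin \o g))%E; first exact: integrableB.
  by apply/funext => x /=; rewrite EFinB.
rewrite -RintegralB//; apply: le_trans (le_normr_Rintegral _ fgi) _ => //.
apply: le_Rintegral => //.
exact: (integrable_norm fgi).
Qed.

End bounded_Rintegral.

(** Choosing one value of [phi] for each word of length [m] replaces [phi] and
    [phi_ n] by a common function of the word, whose integrals converge because
    they are finite sums over cylinders. The words absent from the limit space
    carry no value to choose; the error bound [t] gives them the weight [M], and
    its integral converges to [e / 4] because their limit probability is 0. *)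
Lemma cvg_Rintegral_of_cylinders (R : realType)
    d (T : measurableType d) (P : probability T R) (b : T -> nat -> bool)
    (d_ : nat -> measure_display) (T_ : forall n, measurableType (d_ n))
    (P_ : forall n, probability (T_ n) R) (b_ : forall n, T_ n -> nat -> bool)
    (phi_ : forall n, T_ n -> R) (phi : T -> R) (M : R)
    (mb : forall k, measurable [set x | b x k])
    (mb_ : forall n k, measurable [set x | b_ n x k])
    (cvg_cylinder : forall v, fine (P_ n (cylinder (@b_ n) v)) @[n --> \oo] -->
      fine (P (cylinder b v)))
    (seen_b : forall y m N, exists n, (N <= n)%N /\
      exists x : T_ n, word (b_ n x) m = word (b y) m)
    (mphi_ : forall n, measurable_fun [set: T_ n] (@phi_ n))
    (mphi : measurable_fun [set: T] phi)
    (phi_M : forall n x, `|phi_ n x| <= M) (phiM : forall x, `|phi x| <= M)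
    (close : forall e : R, 0 < e -> exists m, \forall n \near \oo,
      forall (x : T_ n) (y : T), word (b_ n x) m = word (b y) m ->
      `|phi_ n x - phi y| <= e) :
  \int[P_ n]_x phi_ n x @[n --> \oo] --> \int[P]_x phi x.
Proof.
have M0 : 0 <= M by apply: le_trans (phiM point).
have cvg_word (h : seq bool -> R) m :
    \int[P_ n]_x h (word (b_ n x) m) @[n --> \oo] --> \int[P]_x h (word (b x) m).
  rewrite (integral_word P mb).
  have : \sum_(v : m.-tuple bool) h v * fine (P_ n (cylinder (@b_ n) v)) @[n --> \oo]
      --> \sum_(v : m.-tuple bool) h v * fine (P (cylinder b v)).
    apply: cvg_big => [|v _]; first exact: add_continuous.
    by apply: cvgMr; exact: cvg_cylinder.
  apply: cvg_trans; apply: near_eq_cvg; apply: nearW => n.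
  by rewrite (integral_word (P_ n) (mb_ n)).
apply/cvgrPdist_le => e e0.
have e8 : 0 < e / 8 by lra.
have [m close_m] := close _ e8.
pose seen v := `[< exists y, word (b y) m = v >].
pose c v := if pselect (exists y, word (b y) m = v) is left vP
  then phi (projT1 (cid vP)) else 0.
pose t v := e / 4 + (if seen v then 0 else M).
have cM v : `|c v| <= M + e / 4.
  rewrite /c; case: pselect => [vP|_]; last by rewrite normr0; lra.
  by apply: le_trans (phiM _) _; lra.
have tM v : `|t v| <= M + e / 4.
  by rewrite ger0_norm /t; case: ifP; lra.
have me (f : R) : f <= M -> f <= M + e / 4 by lra.
have lim_t : \int[P]_x t (word (b x) m) = e / 4.
  rewrite (@eq_Rintegral _ _ _ P _ (fun=> e / 4)); last first.
    move=> x _; rewrite /t /seen; case: asboolP; first by rewrite addr0.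
    by case; exists x.
  by rewrite Rintegral_cst// [X in fine X]probability_setT mulr1.
have phi_c : `|\int[P]_x phi x - \int[P]_x c (word (b x) m)| <= e / 4.
  rewrite -lim_t; apply: (@ler_dist_Rintegral _ _ _ _ _ _ _ (M + e / 4)) => //.
  - exact: measurable_fun_word.
  - exact: measurable_fun_word.
  - by move=> x; exact: me.
  move=> x; rewrite /c; case: pselect => [vP|[]]; last by exists x.
  case: cid => y /= yx.
  (* two points with the same word are compared through a term of the sequence *)
  have [K _ KP] := close_m.
  have [n [Kn [z zx]]] := seen_b x m K.
  have := KP n Kn z x zx; have := KP n Kn z y (etrans zx (esym yx)).
  rewrite /t ifT; last by apply/asboolP; exists x.
  rewrite !ler_norml; lra.
have [N _ NP] : \forall n \near \oo,
    `|\int[P_ n]_x phi_ n x - \int[P_ n]_x c (word (b_ n x) m)| <=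
    \int[P_ n]_x t (word (b_ n x) m).
  apply: filterS close_m => n close_n.
  apply: (@ler_dist_Rintegral _ _ _ _ _ _ _ (M + e / 4)) => //.
  - exact: measurable_fun_word.
  - exact: measurable_fun_word.
  - by move=> x; exact: me.
  move=> x; rewrite /c /t /seen; case: pselect => [vP|nvP].
    rewrite asboolT// addr0; case: cid => y /= yx.
    by apply: le_trans (close_n _ _ (esym yx)) _; lra.
  by rewrite asboolF// subr0; apply: le_trans (phi_M _ _) _; lra.
have /cvgrPdist_le /(_ (e / 4))c_cvg := cvg_word c m.
have /cvgrPdist_le /(_ (e / 4))t_cvg := cvg_word t m.
rewrite lim_t in t_cvg.
near=> n.
have n1 : `|\int[P]_x c (word (b x) m) - \int[P_ n]_x c (word (b_ n x) m)| <= e / 4.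
  by near: n; apply: c_cvg; lra.
have n2 : `|e / 4 - \int[P_ n]_x t (word (b_ n x) m)| <= e / 4.
  by near: n; apply: t_cvg; lra.
have n3 : `|\int[P_ n]_x phi_ n x - \int[P_ n]_x c (word (b_ n x) m)| <=
    \int[P_ n]_x t (word (b_ n x) m).
  by apply: NP; near: n; exists N.
by have := phi_c; move: n1 n2 n3; rewrite !ler_norml; lra.
Unshelve. all: by end_near. Qed.

(** * Geodesics as curves of affine distance *)

Section geodesics.
Variables (R : realType) (X : metricType R).
Local Notation I := (unit_interval R).
Implicit Types (g : I -> X) (s t : I) (v : R).

Lemma continuous_time : continuous (@time R).
Proof. exact: initial_continuous. Qed.

Lemma time01 t : 0 <= time t <= 1.
Proof. by have := set_mem (valP t); rewrite /= in_itv. Qed.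

Lemma mdist_le_curve_length g s t : le_time s t ->
  ((mdist (g s) (g t))%:E <= curve_length g s t)%E.
Proof.
move=> st; apply: ereal_sup_ubound; exists [:: t]; first by rewrite /= st.
by rewrite /chain_length/= big_seq1.
Qed.

(** Constant speed bounds the distance between two points of the curve by its
    share of the length; by the triangle inequality, a strict inequality
    somewhere would bring the endpoints closer than the length of the curve. *)
Lemma geodesic_mdist g s t : is_geodesic g ->
  mdist (g s) (g t) = `|time s - time t| * mdist (g zero) (g one).
Proof.
move=> [_ ming [v vP]].
have tz : time (zero : I) = 0 by []. have to : time (one : I) = 1 by [].
have vE : v = mdist (g zero) (g one).
  apply: EFin_inj; rewrite -ming vP; last by rewrite /le_time tz to ler01.
  by rewrite tz to subr0 mulr1.
have le_v a b : le_time a b -> mdist (g a) (g b) <= v * (time b - time a).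
  by move=> ab; rewrite -lee_fin -vP//; exact: mdist_le_curve_length.
have eq_v a b : le_time a b -> mdist (g a) (g b) = v * (time b - time a).
  move=> ab; apply/eqP; rewrite eq_le le_v//=.
  have /andP[a0 _] := time01 a; have /andP[_ b1] := time01 b.
  have /le_v za : le_time zero a by rewrite /le_time tz.
  have /le_v bo : le_time b one by rewrite /le_time to.
  have := metric_triangle (g zero) (g a) (g one).
  have := metric_triangle (g a) (g b) (g one).
  by rewrite -vE; rewrite tz to in za bo; lra.
rewrite -vE; have [st|ts] := leP (time s) (time t).
  by rewrite ler0_norm ?subr_le0// opprB mulrC; exact: eq_v.
by rewrite metric_sym gtr0_norm ?subr_gt0// mulrC; apply: eq_v; exact: ltW.
Qed.

(** The chain lengths telescope, so the length of every arc is the distance of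
    its endpoints. *)
Lemma affine_is_geodesic g v :
  (forall s t, mdist (g s) (g t) = `|time s - time t| * v) -> is_geodesic g.
Proof.
move=> gv.
have tz : time (zero : I) = 0 by []. have to : time (one : I) = 1 by [].
have vE : v = mdist (g zero) (g one) by rewrite gv tz to sub0r normrN normr1 mul1r.
have v0 : 0 <= v by rewrite vE mdist_ge0.
have chain s p : path (@le_time R) s p ->
    chain_length g s p = v * (time (last s p) - time s).
  rewrite /chain_length; elim: p s => [|t p IH] s /=.
    by rewrite big_nil subrr mulr0.
  move=> /andP[st tp]; rewrite big_cons/= (IH t)// gv.
  rewrite ler0_norm ?subr_le0//; lra.
have length s t : le_time s t -> curve_length g s t = (v * (time t - time s))%:E.
  move=> st; rewrite /curve_length.
  rewrite (_ : [set _ | _ in _] = [set (v * (time t - time s))%:E]).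
    by rewrite ereal_sup1.
  apply/seteqP; split => [_ [p [sp <-] <-]|_ ->]; first by rewrite chain.
  by exists [:: t]; rewrite /= ?st// chain//= st.
split.
- move=> t.
  apply/(@metricType_numDomainType.cvgrPdist_lt _ _ _ _ (nbhs_filter t)) => e e0.
  have ev : 0 < e / (v + 1) by rewrite divr_gt0// ltr_pwDr.
  have /cvgrPdist_lt /(_ _ ev) := @continuous_time t.
  apply: filterS => s; rewrite gv ltr_pdivlMr ?ltr_pwDr//.
  by apply: le_lt_trans; rewrite ler_wpM2l// lerDl.
- by rewrite /minimizing length /le_time ?tz ?to ?ler01// subr0 mulr1 vE.
- by exists v.
Qed.

Lemma continuous_evaluation t : continuous (@evaluation R X t).
Proof.
move=> g; apply/(@metricType_numDomainType.cvgrPdist_lt _ _ _ _ (nbhs_filter g)) => e e0.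
have : nbhs (\val g : {uniform I -> X})
    [set h : {uniform I -> X} | mdist ((\val g : I -> X) t) (h t) < e].
  apply/uniform_nbhs; exists [set xy : X * X | mdist xy.1 xy.2 < e].
  split; last by move=> h /= /(_ t); apply.
  rewrite -entourage_from_ballE; exists e => // -[x y] /=.
  by rewrite ballEmdist.
exact: (@initial_continuous _ _ _ g).
Qed.

(** The bits of a curve control uniform distances; this relates them to the
    topology that generates the Borel sets of the space of geodesics. *)
Lemma nbhs_geodesic (g : geodesic_space X) (U : set (geodesic_space X)) :
  nbhs g U -> exists2 e : R, 0 < e & forall h : geodesic_space X,
    (forall t, mdist (evaluation t g) (evaluation t h) < e) -> U h.
Proof.
move=> [V [[W oW WV] Vg VU]].
have /uniform_nbhs[E [entE EW]] : nbhs (\val g : {uniform I -> X}) W.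
  by apply: open_nbhs_nbhs; split => //; move: Vg; rewrite -WV.
move: entE; rewrite -entourage_from_ballE => -[e /= e0 eE].
exists e => // h gh; apply: VU; rewrite -WV; apply: EW => t _.
by apply: eE; rewrite /= ballEmdist; exact: gh.
Qed.

End geodesics.

(** * Coding nearly geodesic curves by bits *)

Lemma finite_net (R : realType) (X : pmetricType R) (cptX : compact [set: X])
    (e : R) (e0 : 0 < e) :
  exists s : seq X, forall x, exists2 z, z \in s & mdist z x < e.
Proof.
have : finite_subset_cover [set: X] (fun z => (ball z e)^°) [set: X].
  move: cptX; rewrite compact_cover; apply => [z _|x _]; first exact: open_interior.
  by exists x => //; exact: nbhsx_ballx.
move=> [s _ cover]; exists (finmap.enum_fset s) => x.
have [z zs /interior_subset zx] := cover x I.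
by exists z => //; move: zx; rewrite ballEmdist.
Qed.

Lemma finite_nets (R : realType) (X : pmetricType R) (cptX : compact [set: X]) :
  exists net : nat -> seq X, forall n x,
  exists2 z, z \in net n & mdist z x < n.+1%:R^-1.
Proof.
have /choice[net netP] (n : nat) : exists s : seq X, forall x,
    exists2 z, z \in s & mdist z x < n.+1%:R^-1.
  by apply: finite_net.
by exists net.
Qed.

Lemma compact_mdist_bounded (R : realType) (X : pmetricType R)
    (cptX : compact [set: X]) : exists D : R, forall x y : X, mdist x y <= D.
Proof.
have [s sP] := finite_net cptX ltr01.
pose C := 1 + \sum_(z <- s) mdist point z.
have xC (x : X) : mdist point x <= C.
  have [z zs zx] := sP x.
  have := metric_triangle point z x.
  have : mdist point z <= \sum_(z <- s) mdist point z.
    by rewrite (big_rem z)//= lerDl sumr_ge0// => *; exact: mdist_ge0.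
  by rewrite /C; lra.
exists (C + C) => x y; have := metric_triangle x point y.
by have := xC x; have := xC y; rewrite (metric_sym x point); lra.
Qed.

Section curve_coding.
Variables (R : realType) (X : pmetricType R) (net : nat -> seq X).
Hypothesis cptX : compact [set: X].
Hypothesis netP : forall n x, exists2 z, z \in net n & mdist z x < n.+1%:R^-1.
Local Notation I := (unit_interval R).

(** The ratio is in [[0, 1]] for [j <= n + 1], the only range used; the default
    value of [insubd] covers the rest. *)
Definition sample_time (n j : nat) : I :=
  insubd ((zero : I) : set_type (`[0, 1]%classic : set R)) (j%:R / n.+1%:R).

Lemma sample_time_dense n (t : I) :
  exists2 j, (j < n.+2)%N & `|time (sample_time n j) - time t| <= n.+1%:R^-1.
Proof.
have /andP[t0 t1] := time01 t.
have n0 : 0 < n.+1%:R :> R by [].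
have t0' : 0 <= time t * n.+1%:R by rewrite mulr_ge0// ltW.
have /andP[jl ju] := truncn_itv t0'.
set j := Num.truncn _ in jl ju; exists j.
  rewrite ltnS -(ler_nat R); apply: le_trans jl _.
  by rewrite -[leRHS]mul1r ler_wpM2r// ltW.
have jn : j%:R / n.+1%:R <= time t by rewrite ler_pdivrMr.
have jt : time t < j%:R / n.+1%:R + n.+1%:R^-1.
  by rewrite -[X in _ + X]mul1r -mulrDl ltr_pdivlMr// natr1.
have tE : time (sample_time n j) = j%:R / n.+1%:R.
  rewrite /time /sample_time val_insubd mem_set//= in_itv/= divr_ge0//=.
  exact: le_trans t1.
by rewrite tE ler0_norm ?subr_le0// opprB lerBlDl ltW.
Qed.

(** The question with number [k] is a scale [n], a point [a] of the net at that
    scale and a sampling time [j]: is the curve at that time within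
    [1 / (n + 1)] of that point? Numbers that encode no triple give [false]. *)
Definition curve_bit (g : I -> X) (k : nat) : bool :=
  if unpickle k is Some (n, a, j)
  then mdist (nth point (net n) a) (g (sample_time n j)) < n.+1%:R^-1
  else false.

(** With [delta = 0] these are exactly the geodesics. The images of geodesics
    under approximation maps, which may jump, satisfy it for a small [delta]. *)
Definition coarse_geodesic (delta : R) (g : I -> X) : Prop := forall s t,
  `|mdist (g s) (g t) - `|time s - time t| * mdist (g zero) (g one)| <= delta.

Definition resolves (e : R) (m : nat) (delta : R) : Prop := forall g h,
  coarse_geodesic delta g -> coarse_geodesic delta h ->
  word (curve_bit g) m = word (curve_bit h) m ->
  forall t, mdist (g t) (h t) <= e.

(** Coarse geodesics are equicontinuous up to an additive error, as a bound
    [D] on the diameter of [X] bounds their speed. Hence it suffices to locate them, up to the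
    mesh of a net, at finitely many times. *)
Lemma exists_resolves e : 0 < e ->
  exists m delta, 0 < delta /\ resolves e m delta.
Proof.
move=> e0; have [D DP] := compact_mdist_bounded cptX.
have D0 : 0 <= D by apply: le_trans (DP point point); exact: mdist_ge0.
have e8 : 0 < e / 8 / (D + 1) by rewrite !divr_gt0// ltr_pwDr.
have [n _ nP] := near_infty_natSinv_lt (PosNum e8).
have /= {nP} ne : n.+1%:R^-1 < e / 8 / (D + 1) by apply: nP => /=.
have n0 : 0 < n.+1%:R^-1 :> R by rewrite invr_gt0.
(* an opaque name for the mesh, so that [lra] treats it as an atom *)
have [r rE] : exists r : R, r = n.+1%:R^-1 by exists n.+1%:R^-1.
rewrite -rE in ne n0.
have nD : r * D <= e / 8.
  by move: ne; rewrite ltr_pdivlMr ?ltr_pwDr// mulrDr mulr1; lra.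
have ne8 : r <= e / 8.
  apply: le_trans (ltW ne) _; rewrite ler_pdivrMr ?ltr_pwDr//.
  by rewrite ler_peMr ?lerDr//; lra.
pose m := \max_(p : 'I_(size (net n)) * 'I_n.+2) pickle (n, p.1 : nat, p.2 : nat).
exists m.+1, (e / 8); split; first by lra.
move=> g h cg ch /eq_word gh t.
have [j jn jt] := sample_time_dense n t; rewrite -rE in jt.
set q := sample_time n j in jt.
have near_q f : coarse_geodesic (e / 8) f -> mdist (f q) (f t) <= e / 4.
  move=> /(_ q t); rewrite ler_norml => /andP[_ ft].
  have : `|time q - time t| * mdist (f zero) (f one) <= r * D.
    by rewrite ler_pM ?mdist_ge0.
  lra.
have [z zn zq] := netP n (g q); rewrite -rE in zq.
have bit_g : curve_bit g (pickle (n, index z (net n), j)).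
  by rewrite /curve_bit pickleK nth_index// -rE.
have : curve_bit h (pickle (n, index z (net n), j)).
  rewrite -gh// ltnS; have iz : (index z (net n) < size (net n))%N by rewrite index_mem.
  exact: (leq_bigmax (Ordinal iz, Ordinal jn)).
rewrite /curve_bit pickleK nth_index// -/q -rE => zh.
have := metric_triangle (g t) (g q) (h t).
have := metric_triangle (g q) z (h t).
have := metric_triangle z (h q) (h t).
have := near_q _ cg; have := near_q _ ch.
by rewrite (metric_sym (g t) (g q)) (metric_sym (g q) z); lra.
Qed.

Lemma coarse_geodesic_le d1 d2 g : d1 <= d2 ->
  coarse_geodesic d1 g -> coarse_geodesic d2 g.
Proof. by move=> d12 cg s t; exact: le_trans (cg s t) d12. Qed.

(** Curves [g_ k] that agree with [b] for [k] bits and have coarseness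
    [1 / (k + 1)] become uniformly close to each other and to any other curve
    with a long prefix of [b]; so it is enough to take, at each time, a cluster
    point of their positions. The coarse geodesic equation passes to the limit
    with error 0. The rate is the one of [resolves], the same for all [b]:
    this uniformity gives both the measurability of the limit in [b] and the
    convergence of integrals. *)
Lemma coarse_geodesic_limit (b : nat -> bool) :
  (forall m delta, 0 < delta -> exists g, coarse_geodesic delta g /\
    word (curve_bit g) m = word b m) ->
  exists y : I -> X, is_geodesic y /\ forall e m delta, 0 < delta ->
    resolves e m delta -> forall g, coarse_geodesic delta g ->
    word (curve_bit g) m = word b m -> forall t, mdist (g t) (y t) <= e.
Proof.
move=> approx.
have /choice[g_ g_P] (k : nat) : exists g, coarse_geodesic k.+1%:R^-1 g /\
    word (curve_bit g) k = word b k by exact: approx.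
have /choice[y yP] (t : I) : exists x, cluster (g_ k t @[k --> \oo]) x.
  have [//|x [_ gx]] := cptX (F := g_ k t @[k --> \oo]) _; first exact: filterT.
  by exists x.
have close e m delta : 0 < delta -> resolves e m delta ->
    forall g, coarse_geodesic delta g ->
    word (curve_bit g) m = word b m -> forall t, mdist (g t) (y t) <= e.
  move=> d0 res g cg gb t; apply/ler_addgt0Pr => eta eta0.
  have [N _ NP] := near_infty_natSinv_lt (PosNum d0).
  have [||_ [[k /= mk <-]]] := yP t [set g_ k t | k in [set k | (maxn N m <= k)%N]]
      (ball (y t) eta).
  - by exists (maxn N m) => // k /= mk; exists k.
  - exact: nbhsx_ballx.
  rewrite ballEmdist/= => yg.
  move: mk; rewrite geq_max => /andP[Nk mk].
  have [cgk gkb] := g_P k.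
  have gt : mdist (g t) (g_ k t) <= e.
    apply: res => //; first by apply: coarse_geodesic_le cgk; exact/ltW/NP.
    by rewrite gb; apply/esym/(word_leq mk).
  have := metric_triangle (g t) (g_ k t) (y t).
  by rewrite (metric_sym (g_ k t) (y t)); lra.
exists y; split=> //; apply: (@affine_is_geodesic _ _ _ (mdist (y zero) (y one))) => s t.
have st1 : `|time s - time t| <= 1.
  by have := time01 s; have := time01 t; rewrite ler_norml; lra.
have st0 : 0 <= `|time s - time t| by [].
have small e : 0 < e ->
    `|mdist (y s) (y t) - `|time s - time t| * mdist (y zero) (y one)| <= 5 * e.
  move=> e0; have [m [delta [d0 res]]] := exists_resolves e0.
  have de : 0 < Num.min delta e by rewrite lt_min d0.
  have [g [cg gb]] := approx m _ de.
  have {}close u : mdist (g u) (y u) <= e.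
    apply: close res _ _ gb u => //; apply: coarse_geodesic_le cg.
    by rewrite ge_min lexx.
  have dist_gy u v : `|mdist (y u) (y v) - mdist (g u) (g v)| <= 2 * e.
    have := close u; have := close v.
    have := metric_triangle (y u) (g u) (y v); have := metric_triangle (g u) (g v) (y v).
    have := metric_triangle (g u) (y u) (g v); have := metric_triangle (y u) (y v) (g v).
    rewrite (metric_sym (y u) (g u)) (metric_sym (y v) (g v)) ler_norml; lra.
  have : `|mdist (g s) (g t) - `|time s - time t| * mdist (g zero) (g one)| <= e.
    by apply: le_trans (cg s t) _; rewrite ge_min lexx orbT.
  have := dist_gy s t.
  have : `| `|time s - time t| *
            (mdist (y zero) (y one) - mdist (g zero) (g one))| <= 1 * (2 * e).
    by rewrite normrM ler_pM// normr_id.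
  rewrite mulrBr !ler_norml; lra.
apply/eqP; rewrite -subr_eq0 -normr_eq0 eq_le normr_ge0 andbT.
apply/ler_addgt0Pr => e e0; rewrite add0r.
have e5 : 0 < e / 5 by lra.
by have := small _ e5; lra.
Qed.

End curve_coding.

(** * Borel maps and weak-* convergence *)

Section borel_maps.

Lemma continuous_borel_measurable (K L : ptopologicalType) (f : K -> L) :
  continuous f -> measurable_fun [set: borel K] (f : borel K -> borel L).
Proof.
move=> /continuousP cf; apply: (measurability _
  (erefl : @measurable _ (borel L) = <<s @open L >>)).
move=> _ [U oU <-]; rewrite setTI; apply: sub_sigma_algebra; exact: cf.
Qed.

Lemma continuous_real_measurable (R : realType) (K : ptopologicalType) (h : K -> R) :
  continuous h -> measurable_fun [set: borel K] h.
Proof.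
move=> /continuousP ch; apply: (measurability _ (RGenOpens.measurableE R)).
move=> _ [_ [a [b ->] <-]]; rewrite setTI.
by apply: sub_sigma_algebra; apply: ch; exact: interval_open.
Qed.

Lemma open_mdist_ball (R : realType) (X : metricType R) (z : X) (r : R) :
  open [set x | mdist z x < r].
Proof.
rewrite openE => x /= zx; apply/nbhs_ballP; exists (r - mdist z x).
  by rewrite /= subr_gt0.
move=> y; rewrite ballEmdist /= => xy.
by have := metric_triangle z x y; lra.
Qed.

(** The Borel sets of the product are those of the product sigma-algebra,
    because every open set is a countable union of boxes centered at net
    points. *)
Lemma measurable_pair_borel (R : realType) (X : pmetricType R)
    (cptX : compact [set: X]) d (T : measurableType d) (f g : T -> X) :
  measurable_fun [set: T] (f : T -> borel X) ->
  measurable_fun [set: T] (g : T -> borel X) ->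
  measurable_fun [set: T] ((fun x => (f x, g x)) : T -> borel (X * X)%type).
Proof.
move=> mf mg; apply: (measurability _
  (erefl : @measurable _ (borel (X * X)%type) = <<s @open (X * X)%type >>)).
move=> _ [U oU <-]; rewrite setTI.
have [net netP] := finite_nets cptX.
pose box (i : nat * nat * nat) := let: (n, a, b) := i in
  [set x : X * X | mdist (nth point (net n) a) x.1 < n.+1%:R^-1 /\
                   mdist (nth point (net n) b) x.2 < n.+1%:R^-1].
rewrite (_ : _ @^-1` _ = \bigcup_i
    [set x | box i `<=` U /\ box i (f x, g x)]).
  apply: countable_bigcupT_measurable => // i.
  have [iU|iU] := pselect (box i `<=` U); last first.
    by rewrite (_ : [set _ | _] = set0)//; apply/seteqP; split => x //= -[].
  case: i iU => [[n a] b] iU.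
  rewrite (_ : [set _ | _] =
      (f @^-1` [set x | mdist (nth point (net n) a) x < n.+1%:R^-1]) `&`
      (g @^-1` [set x | mdist (nth point (net n) b) x < n.+1%:R^-1])).
    apply: measurableI; rewrite -[X in measurable X]setTI; [apply: mf|apply: mg] => //.
      by apply: sub_sigma_algebra; exact: open_mdist_ball.
    by apply: sub_sigma_algebra; exact: open_mdist_ball.
  by apply/seteqP; split => [x []|x].
apply/seteqP; split => [x Ux|x [i _ [iU]]]; last exact: iU.
have : nbhs (f x, g x) U by apply: open_nbhs_nbhs.
move=> /nbhs_ballP[e /= e0 eU].
have e2 : 0 < e / 2 by lra.
have [n _ nP] := near_infty_natSinv_lt (PosNum e2).
have ne : n.+1%:R^-1 < e / 2 by apply: (nP n) => /=.
have [a an ax] := netP n (f x); have [b bn bx] := netP n (g x).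
exists (n, index a (net n), index b (net n)) => //=; rewrite !nth_index//.
split=> // -[y1 y2] [/= ay by2]; apply: eU.
split; rewrite /= ballEmdist/=.
- have := metric_triangle (f x) a y1; rewrite (metric_sym (f x) a).
  by move: ax ay ne; set r := _^-1; lra.
- have := metric_triangle (g x) b y2; rewrite (metric_sym (g x) b).
  by move: bx by2 ne; set r := _^-1; lra.
Qed.

End borel_maps.

(** Heine-Cantor, with [near_covering] in the role of the Lebesgue number. *)
Lemma compact_uniformly_continuous (R : realType) (K : pseudoMetricType R)
    (cptK : compact [set: K]) (h : K -> R) (ch : continuous h) (e : R) (e0 : 0 < e) :
  exists2 delta : R, 0 < delta & forall x y, ball x delta y -> `|h x - h y| < e.
Proof.
have e2 : 0 < e / 2 by lra.
have /compact_near_coveringP/(_ _ (0 : R)^'+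
    (fun delta x => forall y, ball x delta y -> `|h x - h y| < e)) := cptK.
case.
- move=> x _; have /cvgrPdist_lt /(_ _ e2) := ch x.
  move=> /nbhs_ballP[r /= r0 rP]; have r2 : 0 < r / 2 by rewrite divr_gt0.
  exists (ball x (r / 2), [set delta | delta < r / 2]).
    split; first exact: nbhsx_ballx.
    exact: nbhs_right_lt.
  move=> [z delta] [/= xz dr] y zy.
  have hz : `|h x - h z| < e / 2.
    by apply: rP; apply: le_ball xz; rewrite ler_pdivrMr//; lra.
  have hy : `|h x - h y| < e / 2.
    apply: rP; rewrite [r]splitr; apply: ball_triangle xz _.
    by apply: le_ball zy; exact: ltW.
  by move: hz hy; rewrite !ltr_norml; lra.
move=> r /= r0 rP; exists (r / 2); first by rewrite divr_gt0.
move=> x y; apply: rP; rewrite //= ?divr_gt0//.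
by rewrite sub0r normrN gtr0_norm ?divr_gt0// ltr_pdivrMr//; lra.
Qed.

(** The change of variables reduces weak-* convergence of images to convergence
    of integrals over spaces of bit sequences. *)
Lemma weak_star_cvg_of_cylinders (R : realType) (K : ptopologicalType)
    (cptK : compact [set: K])
    d (T : measurableType d) (P : probability T R) (b : T -> nat -> bool)
    (d_ : nat -> measure_display) (T_ : forall n, measurableType (d_ n))
    (P_ : forall n, probability (T_ n) R) (b_ : forall n, T_ n -> nat -> bool)
    (a_ : forall n, T_ n -> K) (a : T -> K)
    (mb : forall k, measurable [set x | b x k])
    (mb_ : forall n k, measurable [set x | b_ n x k])
    (cvg_cylinder : forall v, fine (P_ n (cylinder (@b_ n) v)) @[n --> \oo] -->
      fine (P (cylinder b v)))
    (seen_b : forall y m N, exists n, (N <= n)%N /\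
      exists x : T_ n, word (b_ n x) m = word (b y) m)
    (ma_ : forall n, measurable_fun [set: T_ n] (@a_ n : T_ n -> borel K))
    (ma : measurable_fun [set: T] (a : T -> borel K))
    (close : forall h : K -> R, continuous h -> forall e : R, 0 < e ->
      exists m, \forall n \near \oo,
      forall (x : T_ n) (y : T), word (b_ n x) m = word (b y) m ->
      `|h (a_ n x) - h (a y)| <= e) :
  weak_star_cvg (fun n => pushforward (P_ n) (@a_ n : T_ n -> borel K))
    (pushforward P (a : T -> borel K)).
Proof.
move=> h ch; have mh := continuous_real_measurable ch.
have [M hM] : exists M, forall x, `|h x| <= M.
  have /compact_bounded[M [_ hM]] : compact [set h x | x in [set: K]].
    by apply: continuous_compact => //; exact: continuous_subspaceT.
  exists (M + 1) => x; apply: hM; first by rewrite ltrDl.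
  by exists x.
have int_pushforward d' (T' : measurableType d') (Q : probability T' R) (c : T' -> K) :
    measurable_fun [set: T'] (c : T' -> borel K) ->
    (\int[pushforward Q (c : T' -> borel K)]_(x in [set: borel K]) (h x)%:E)%E =
    (\int[Q]_x h (c x))%:E.
  move=> mc; have mhc : measurable_fun [set: T'] (h \o c).
    exact: (measurableT_comp mh mc).
  have ic := probability_bounded_integrable Q mhc (fun x => hM (c x)).
  rewrite integral_pushforward//; last exact/measurable_EFinP.
  by rewrite preimage_setT /Rintegral fineK//; exact: (integrable_fin_num _ ic).
rewrite int_pushforward//; under eq_fun do rewrite int_pushforward//.
apply: cvg_EFin; first by apply: nearW.
apply: (cvg_Rintegral_of_cylinders (b := b) (b_ := b_) (M := M)) => //.
- by move=> n; exact: (measurableT_comp mh (ma_ n)).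
- exact: (measurableT_comp mh ma).
- exact: close.
Qed.

(** * Limits of dynamical transference plans *)

Lemma measurable_curve_bit (R : realType) (X : pmetricType R) (net : nat -> seq X)
    d (T : measurableType d) (g : T -> unit_interval R -> X)
    (mg : forall t, measurable_fun [set: T] ((fun x => g x t) : T -> borel X)) k :
  measurable [set x | curve_bit net (g x) k].
Proof.
rewrite /curve_bit; case: unpickle => [[[n a] j]|]; last first.
  by rewrite (_ : [set _ | _] = set0)//; apply/seteqP; split.
pose U := [set x : X | mdist (nth point (net n) a) x < n.+1%:R^-1].
have mU : measurable (U : set (borel X)).
  by apply: sub_sigma_algebra; exact: open_mdist_ball.
by have := mg (sample_time R n j) measurableT U mU; rewrite setTI.
Qed.

(** One [eps] is lost on the distance between the two points, the other on the
    speed, which is multiplied by a time of at most 1. *)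
Lemma coarse_geodesic_approximation (R : realType) (Y X : pmetricType R)
    (eps : R) (f : Y -> X) (g : geodesic_space Y) : eps_approximation eps f ->
  coarse_geodesic (2 * eps) (fun t => f (evaluation t g)).
Proof.
move=> [_ f_eps _] s t.
have gE := geodesic_mdist s t (set_mem (valP g)).
have := f_eps (evaluation s g) (evaluation t g).
have := f_eps (evaluation zero g) (evaluation one g).
rewrite /evaluation {}gE; set p := mdist (f _) _; set q := mdist (f _) _ => h0 hst.
have st1 : `|time s - time t| <= 1.
  by have := time01 s; have := time01 t; rewrite ler_norml; lra.
have : `| `|time s - time t| *
          (p - mdist ((\val g : _ -> Y) zero) ((\val g : _ -> Y) one))| <= 1 * eps.
  by rewrite normrM ler_pM// normr_id.
by move: hst; rewrite mulrBr !ler_norml; lra.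
Qed.

Theorem theoremA45 (R : realType)
  (X_ : nat -> pmetricType R) (X : pmetricType R)
  (cptX_ : forall i, compact [set: X_ i])
  (lenX_ : forall i, length_space (X_ i))
  (cptX : compact [set: X])
  (lenX : length_space X)
  (eps_ : nat -> R) (f_ : forall i, X_ i -> X)
  (eps0 : eps_ i @[i --> \oo] --> (0 : R))
  (approx_f : forall i, eps_approximation (eps_ i) (f_ i))
  (Pi_ : forall i, probability (borel (geodesic_space (X_ i))) R) :
  exists k : nat -> nat, {homo k : m n / (m < n)%N >-> (m < n)%N} /\
  exists Pi : probability (borel (geodesic_space X)) R,
    weak_star_cvg
      (fun n => borel_pushforward (prod_map (@f_ (k n)))
                  (transference_plan (Pi_ (k n))))
      (transference_plan Pi) /\
    forall t : unit_interval R,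
      weak_star_cvg
        (fun n => borel_pushforward (@f_ (k n))
                    (measure_path (Pi_ (k n)) t))
        (measure_path Pi t).
Proof.
have [net netP] := finite_nets cptX.
(* the curve that a geodesic of [X_ i] leaves in [X] *)
pose shadow i (g : geodesic_space (X_ i)) t := f_ i (evaluation t g).
have mshadow i t : measurable_fun [set: borel (geodesic_space (X_ i))]
    ((fun g => shadow i g t) : _ -> borel X).
  have [mf _ _] := approx_f i.
  have mev := continuous_borel_measurable (@continuous_evaluation R (X_ i) t).
  exact: (measurableT_comp mf mev).
pose b_ i (g : borel (geodesic_space (X_ i))) := curve_bit net (shadow i g).
have mb_ i j : measurable [set g | b_ i g j].
  by apply: measurable_curve_bit => t; exact: mshadow.
have [k [k_incr [B [mB cvgB seenB]]]] := code_subsequence Pi_ mb_.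
exists k; split => //.
have k_ge n : (n <= k n)%N.
  by elim: n => // n IH; apply: leq_ltn_trans IH (k_incr _ _ _).
have coarse_k delta : 0 < delta -> \forall n \near \oo,
    forall g, coarse_geodesic delta (shadow (k n) g).
  move=> d0; have d2 : 0 < delta / 2 by rewrite divr_gt0.
  have /cvgrPdist_lt /(_ _ d2)[N _ NP] := eps0; exists N => // n /= Nn g.
  apply: coarse_geodesic_le (coarse_geodesic_approximation g (approx_f (k n))).
  have := NP (k n) (leq_trans Nn (k_ge n)).
  by rewrite sub0r normrN => /ltr_normlW; lra.
have /choice[G GP] (u : R) : exists y : geodesic_space X,
    forall e m delta, 0 < delta -> resolves net e m delta ->
    forall g, coarse_geodesic delta g ->
    word (curve_bit net g) m = word (B u) m ->
    forall t, mdist (g t) (evaluation t y) <= e.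
  have [m delta d0|y [y_geod yP]] := coarse_geodesic_limit cptX netP (b := B u).
    have [N _ NP] := coarse_k _ d0.
    have [n [Nn [g gu]]] := seenB u m N.
    by exists (shadow (k n) g); split=> //; exact: NP.
  by exists (exist (fun g => g \in @is_geodesic R X) y (mem_set y_geod)).
have close e : 0 < e -> exists m, \forall n \near \oo, forall g u,
    word (b_ (k n) g) m = word (B u) m ->
    forall t, mdist (shadow (k n) g t) (evaluation t (G u)) <= e.
  move=> e0; have [m [delta [d0 res]]] := exists_resolves cptX netP e0.
  exists m; apply: filterS (coarse_k _ d0) => n coarse g u gu.
  exact: GP res _ (coarse g) gu.
(* [G] is nearly constant on cylinders of long words, so the inverse image of
   an open set is the union of the cylinders that it contains *)
have mG : measurable_fun [set: measurableTypeR R] (G : _ -> borel (geodesic_space X)).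
  apply: (measurability _ (erefl : @measurable _ (borel (geodesic_space X)) =
    <<s @open (geodesic_space X) >>)).
  move=> _ [U oU <-]; rewrite setTI.
  rewrite (_ : _ @^-1` _ = \bigcup_v
      [set u | cylinder B v `<=` G @^-1` U /\ cylinder B v u]).
    apply: countable_bigcupT_measurable => // v.
    have [vU|vU] := pselect (cylinder B v `<=` G @^-1` U); last first.
      by rewrite (_ : [set _ | _] = set0)//; apply/seteqP; split => x //= -[].
    rewrite (_ : [set _ | _] = cylinder B v); first exact: measurable_cylinder.
    by apply/seteqP; split => [x []|x].
  apply/seteqP; split => [u Uu|u [v _ [vU]]]; last exact: vU.
  have [e e0 eU] := nbhs_geodesic (open_nbhs_nbhs (conj oU Uu)).
  have e4 : 0 < e / 4 by lra.
  have [m [N _ NP]] := close _ e4.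
  exists (word (B u) m) => //; split; last by rewrite /cylinder/= size_word.
  move=> u'; rewrite /cylinder/= size_word => u'u; apply: eU => t.
  have [n [Nn [g gu]]] := seenB u m N.
  have := NP n Nn g u gu t; have := NP n Nn g u' (etrans gu (esym u'u)) t.
  have := metric_triangle (evaluation t (G u)) (shadow (k n) g t) (evaluation t (G u')).
  by rewrite (metric_sym (evaluation t (G u)) (shadow _ _ _)); lra.
pose Gm : {mfun measurableTypeR R >-> borel (geodesic_space X)} :=
  HB.pack (G : measurableTypeR R -> borel (geodesic_space X))
    (isMeasurableFun.Build _ _ _ _ _ mG).
exists (distribution (@unit_lebesgue R) Gm).
have mGt t : measurable_fun [set: measurableTypeR R]
    ((fun u => evaluation t (G u)) : _ -> borel X).
  have mev := continuous_borel_measurable (@continuous_evaluation R X t).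
  exact: (measurableT_comp mev mG).
split.
  have cptXX : compact [set: X * X].
    by have := compact_setX cptX cptX; rewrite setXTT.
  apply: (@weak_star_cvg_of_cylinders R (X * X)%type _ _ _ (@unit_lebesgue R) B
    _ _ (fun n => Pi_ (k n)) (fun n => b_ (k n))
    (fun n g => (shadow (k n) g zero, shadow (k n) g one))
    (fun u => endpoints (G u))) => //.
  - by move=> n; apply: measurable_pair_borel => //; exact: mshadow.
  - exact: measurable_pair_borel.
  move=> h ch e e0.
  have [delta d0 hP] := compact_uniformly_continuous cptXX ch e0.
  have d2 : 0 < delta / 2 by lra.
  have [m near_m] := close _ d2; exists m; apply: filterS near_m => n nP g u gu.
  apply/ltW/hP; split; rewrite /= ballEmdist/=;
    by apply: le_lt_trans (nP g u gu _) _; lra.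
move=> t.
apply: (@weak_star_cvg_of_cylinders R X _ _ _ (@unit_lebesgue R) B
  _ _ (fun n => Pi_ (k n)) (fun n => b_ (k n))
  (fun n g => shadow (k n) g t) (fun u => evaluation t (G u))) => //.
move=> h ch e e0.
have [delta d0 hP] := compact_uniformly_continuous cptX ch e0.
have d2 : 0 < delta / 2 by lra.
have [m near_m] := close _ d2; exists m; apply: filterS near_m => n nP g u gu.
apply/ltW/hP; rewrite ballEmdist/=.
by apply: le_lt_trans (nP g u gu _) _; lra.
Qed.
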